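(* Let $p\in\mathcal{P}$ and $l>0$ (a real number). Then $$\lim_{k\downarrow 0}elo_k(p)=\lim_{k\downarrow 0}elo_l(k\cdot p)=0$$ and $$\lim_{k\downarrow 0}\frac{elo_k(p)}{k}=\lim_{k\downarrow 0}\frac{elo_l(k\cdot p)}{k\cdot l}=\left(\sum_{j\in n}\frac{p_{ij}-p_{ji}}{2}\right)_{i\in n}.$$
   Context: Fix $n\in\mathbb{N}$ with $n\geq 2$ and identify $n=\{0,1,\dots,n-1\}$ (so $i\in n$ means $0\le i\le n-1$). The rating space is $\mathcal{R}:=\{x\in\mathbb{R}^n\mid\sum_{i\in n}x_i=0\}$, with norm $\lVert\cdot\rVert_1$. The space of competition results is $\mathcal{P}:=\{p\in\mathbb{R}^{n\times n}\mid p_{ij}\geq 0\text{ for all }i,j\in n,\ p_{ii}=0\text{ for all }i\in n\}$. For $k>0$, the classical Elo map is $$elo_k^{cl}:\mathcal{R}\times\mathcal{P}\rightarrow\mathcal{R},\quad (x,p)\mapsto k\cdot\left(\sum_{j\in n}\left(p_{ij}-\frac{p_{ij}+p_{ji}}{1+\exp(x_j-x_i)}\right)\right)_{i\in n}.$$ For every $k>0$ and $p\in\mathcal{P}$ there is exactly one $x\in\mathcal{R}$ with $x=elo_k^{cl}(x,p)$; it is denoted $elo_k(p)$ (the self-justifying rating with respect to $p$ and $k$). *)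

(* Defs.v *)
From HB Require Import structures.
From mathcomp Require Import all_boot all_order all_algebra.
From mathcomp Require Import all_classical all_reals all_analysis.

Set Implicit Arguments.
Unset Strict Implicit.
Unset Printing Implicit Defensive.

Import Order.TTheory GRing.Theory Num.Theory.
Import numFieldNormedType.Exports.

Local Open Scope classical_set_scope.
Local Open Scope ring_scope.

Definition rating (R : realType) (n : nat) : set 'rV[R]_n :=
  [set x | \sum_i x ord0 i = 0].

Definition norm1 (R : realType) (n : nat) (x : 'rV[R]_n) : R :=
  \sum_i `|x ord0 i|.

(* The topology on row vectors is that of the max norm; convergence in it is
   convergence in [norm1]. *)
Lemma cvg_norm1P (R : realType) (n : nat) (T : Type) (F : set_system T)
    (FF : Filter F) (f : T -> 'rV[R]_n) (a : 'rV[R]_n) :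
  (f t @[t --> F] --> a) <-> (norm1 (f t - a) @[t --> F] --> (0 : R)).
Proof.
have norm1_ge0 (x : 'rV[R]_n) : 0 <= norm1 x by apply: sumr_ge0.
have ge_norm1 (x : 'rV[R]_n) : `|x| <= norm1 x.
  rewrite [leLHS]/Num.norm /= mx_normrE; apply/bigmax_leP; split=> // -[i j] _.
  rewrite ord1 /= /norm1 (bigD1 j) //= lerDl.
  exact: sumr_ge0.
have le_norm1 (x : 'rV[R]_n) : norm1 x <= n%:R * `|x|.
  have -> : n%:R * `|x| = \sum_(i < n) `|x|.
    by rewrite sumr_const card_ord mulr_natl.
  apply: ler_sum => i _; rewrite [leRHS]/Num.norm /= mx_normrE.
  by apply/bigmax_geP; right => /=; exists (ord0, i).
split=> [/cvgrPdist_lt h|/cvgr0Pnorm_lt h].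
- apply/cvgr0Pnorm_lt => e e0.
  have n1 : 0 < n.+1%:R :> R by rewrite ltr0n.
  apply: filterS (h (e / n.+1%:R) (divr_gt0 e0 n1)) => t.
  rewrite ltr_pdivlMr // distrC ger0_norm // mulrC.
  by apply: le_lt_trans; rewrite (le_trans (le_norm1 _)) ?ler_wpM2r ?ler_nat.
- apply/cvgrPdist_lt => e e0; apply: filterS (h e e0) => t.
  by rewrite distrC ger0_norm //; apply: le_lt_trans.
Qed.

Definition competition (R : realType) (n : nat) : set 'M[R]_n :=
  [set p | (forall i j, 0 <= p i j) /\ (forall i, p i i = 0)].

Definition elo_cl (R : realType) (n : nat) (k : R) (x : 'rV[R]_n)
    (p : 'M[R]_n) : 'rV[R]_n :=
  k *: \row_i \sum_j
    (p i j - (p i j + p j i) / (1 + expR (x ord0 j - x ord0 i))).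

Lemma elo_cl_rating (R : realType) (n : nat) (k : R) (x : 'rV[R]_n)
    (p : 'M[R]_n) : rating (elo_cl k x p).
Proof.
rewrite /rating /=.
under eq_bigr do rewrite !mxE.
rewrite -mulr_sumr; apply/eqP; rewrite mulf_eq0; apply/orP; right.
set S := \sum_i _; suff : S + S = 0.
  by move/eqP; rewrite -mulr2n mulrn_eq0.
rewrite {2}/S exchange_big /= /S -big_split big1 // => i _.
rewrite /= -big_split big1 // => j _ /=.
have e (a b : R) : (1 + expR (a - b))^-1 = expR b / (expR a + expR b).
  have ha := expR_gt0 a; have hb := expR_gt0 b.
  rewrite expRD expRN -[1](divff (lt0r_neq0 hb)) -mulrDl invf_div.
  by rewrite [expR b + _]addrC.
rewrite !e [expR (x _ i) + _]addrC [p j i + p i j]addrC.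
rewrite addrACA -opprD -mulrDr -mulrDl [expR (x _ i) + _]addrC divff ?mulr1 ?subrr //.
by rewrite lt0r_neq0 // addr_gt0 // expR_gt0.
Qed.

(* The unique rating fixed by [elo_cl k ^~ p] for [k > 0] and [competition p];
   the default value 0 of [xget] plays no role in that range. *)
Definition elo (R : realType) (n : nat) (k : R) (p : 'M[R]_n) : 'rV[R]_n :=
  xget 0 [set x | rating x /\ x = elo_cl k x p].

(* Main.v *)
(* For x = elo_k(p) one has x = k G(x), where G = elo_cl 1 is Lipschitz with
   some constant M because the logistic function is. As soon as k M < 1 the map
   k G is a contraction, so the fixed point exists, and 2 k M <= 1 gives
   |x| <= 2 k |G(0)|; hence |x / k - G(0)| = |G(x) - G(0)| <= 2 k M |G(0)|.
   The other two limits reduce to these by elo_l(k p) = elo_(k l)(p). *)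

Require Import Defs.
From HB Require Import structures.
From mathcomp Require Import all_boot all_order all_algebra.
From mathcomp Require Import all_classical all_reals all_analysis ring lra.

Set Implicit Arguments.
Unset Strict Implicit.
Unset Printing Implicit Defensive.

Import Order.TTheory GRing.Theory Num.Theory.
Import numFieldNormedType.Exports.

Local Open Scope classical_set_scope.
Local Open Scope ring_scope.

(* The library has the normed and the complete structure on matrices, but not
   their join, which [banach_fixed_point] needs. *)
HB.instance Definition _ (R : realType) (m n : nat) :=
  Complete.on 'M[R]_(m, n).

Section row_norm.
Variables (R : realType) (n : nat).
Implicit Types x : 'rV[R]_n.

Lemma ler_coord_norm x i : `|x ord0 i| <= `|x|.
Proof.
rewrite [leRHS]/Num.norm /= mx_normrE.
by apply/bigmax_geP; right => /=; exists (ord0, i).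
Qed.

Lemma row_norm_le x c : 0 <= c -> (forall i, `|x ord0 i| <= c) -> `|x| <= c.
Proof.
move=> c0 h; rewrite [leLHS]/Num.norm /= mx_normrE.
by apply/bigmax_leP; split=> // -[i j] _; rewrite ord1.
Qed.

End row_norm.

(** For [a <= b] the difference is [(expR b - expR a) / ((1 + expR a) * (1 + expR b))]. The tangent
    bound [1 + t <= expR t] at [t = a - b] bounds the numerator by [expR b * (b - a)], and the
    denominator is at least [expR b]. *)
Lemma logistic_lipschitz (R : realType) (a b : R) :
  `|(1 + expR a)^-1 - (1 + expR b)^-1| <= `|a - b|.
Proof.
wlog ab : a b / a <= b => [hw|].
  by have [/hw//|/ltW/hw] := leP a b; rewrite distrC [X in _ <= X]distrC.
have A0 := expR_gt0 a; have B0 := expR_gt0 b.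
have A1 : 0 < 1 + expR a by rewrite addr_gt0.
have B1 : 0 < 1 + expR b by rewrite addr_gt0.
have AB : expR a <= expR b by rewrite ler_expR.
rewrite ger0_norm ?subr_ge0 ?lef_pV2 ?posrE ?lerD2l//.
rewrite distrC ger0_norm ?subr_ge0//.
have BA : expR b - expR a <= expR b * (b - a).
  have := expR_ge1Dx (a - b); rewrite -(ler_pM2l B0) -expRD [b + _]addrC subrK.
  rewrite mulrDr mulr1 => h.
  by rewrite lerBlDr -lerBlDl -mulrN opprB.
have -> : (1 + expR a)^-1 - (1 + expR b)^-1 =
    (expR b - expR a) / ((1 + expR a) * (1 + expR b)).
  by field; rewrite !lt0r_neq0.
rewrite ler_pdivrMr ?mulr_gt0// (le_trans BA)// mulrC ler_wpM2l ?subr_ge0//.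
by have := mulr_gt0 A0 B0; lra.
Qed.

Lemma cvg_at_right0_linear (R : realType) (V : normedModType R) (f : R -> V)
    (a : V) (c e : R) :
  0 < e -> (forall k, 0 < k -> k <= e -> `|f k - a| <= c * k) ->
  f k @[k --> 0^'+] --> a.
Proof.
move=> e0 fc; apply/cvgrPdist_le => d d0; near=> k.
have k0 : 0 < k by near: k; exact: nbhs_right_gt.
rewrite distrC (le_trans (fc _ k0 _))//.
  by near: k; exact: nbhs_right_le.
(* Passing from [c] to its absolute value plus one gives a positive divisor whatever the sign of
   [c]. *)
rewrite (@le_trans _ _ ((`|c| + 1) * k))//.
  by rewrite ler_pM2r// (le_trans (ler_norm c))// lerDl.
rewrite mulrC -ler_pdivlMr ?ltr_wpDl//.
by near: k; apply: nbhs_right_le; rewrite divr_gt0// ltr_wpDl.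
Unshelve. all: by end_near. Qed.

Lemma cvg_at_right0_scale (R : realType) (T : topologicalType) (f : R -> T)
    (a : T) (l : R) :
  0 < l -> f k @[k --> 0^'+] --> a -> f (k * l) @[k --> 0^'+] --> a.
Proof.
(* The ball of radius [e] pulls back to [k < e / l]. *)
move=> l0; apply: (@cvg_comp _ _ _ ( *%R^~ l)) => A [e /= e0 eA]; near=> k.
have k0 : 0 < k by near: k; exact: nbhs_right_gt.
apply: eA; last by rewrite mulr_gt0.
rewrite /= sub0r normrN gtr0_norm ?mulr_gt0// -ltr_pdivlMr//.
by near: k; apply: nbhs_right_lt; rewrite divr_gt0.
Unshelve. all: by end_near. Qed.

Section elo.
Variables (R : realType) (n : nat).
Implicit Types (p : 'M[R]_n) (x y : 'rV[R]_n) (k l : R).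

Lemma elo_cl_scale k x p : elo_cl k x p = k *: elo_cl 1 x p.
Proof. by rewrite /elo_cl scale1r. Qed.

Lemma elo_cl_scaler l k x p : elo_cl l x (k *: p) = elo_cl (k * l) x p.
Proof.
apply/rowP => i; rewrite !mxE [k * l]mulrC -mulrA; congr (_ * _).
rewrite mulr_sumr; apply: eq_bigr => j _.
by rewrite !mxE -mulrDr -mulrA -mulrBr.
Qed.

(** Both fixed-point equations have the same solution set, and [xget] depends only on that set. *)
Lemma elo_scaler l k p : elo l (k *: p) = elo (k * l) p.
Proof.
rewrite /elo; congr (xget _ _); apply/seteqP.
by split => x [? ?]; split=> //; rewrite ?elo_cl_scaler // -elo_cl_scaler.
Qed.

(** At equal ratings every logistic factor is 1/2; this identifies the limit in the theorem. *)
Lemma elo_cl0 p :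
  elo_cl 1 0 p = \row_i \sum_j (p i j - p j i) / 2.
Proof.
apply/rowP => i; rewrite !mxE mul1r; apply: eq_bigr => j _.
by rewrite !mxE subrr expR0; field.
Qed.

(** The double sum dominates every row sum at once; the factor 2 arises because a difference of two
    coordinates moves by at most twice the max norm. *)
Definition elo_lip p : R := 2 * \sum_i \sum_j `|p i j + p j i|.

Lemma elo_lip_ge0 p : 0 <= elo_lip p.
Proof. by rewrite mulr_ge0// sumr_ge0// => i _; rewrite sumr_ge0. Qed.

Lemma elo_cl_lipschitz p x y :
  `|elo_cl 1 x p - elo_cl 1 y p| <= elo_lip p * `|x - y|.
Proof.
apply: row_norm_le => [|i]; first by rewrite mulr_ge0// elo_lip_ge0.
rewrite !mxE !mul1r -sumrB (le_trans (ler_norm_sum _ _ _))//.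
rewrite (@le_trans _ _ (\sum_j `|p i j + p j i| * (2 * `|x - y|)))//.
  apply: ler_sum => j _.
  rewrite opprB addrC addrA subrK -mulrBr normrM ler_wpM2l//.
  rewrite distrC (le_trans (logistic_lipschitz _ _))//.
  have := ler_coord_norm (x - y) i; have := ler_coord_norm (x - y) j.
  rewrite !mxE => hj hi.
  rewrite (_ : _ - _ = (x ord0 j - y ord0 j) - (x ord0 i - y ord0 i)).
    by rewrite (le_trans (ler_normB _ _))// mulr_natl mulr2n lerD.
  by ring.
rewrite -mulr_suml /elo_lip -mulrA [leRHS]mulrCA ler_wpM2r ?mulr_ge0//.
by rewrite [leRHS](bigD1 i)//= lerDl sumr_ge0// => k _; rewrite sumr_ge0.
Qed.

Lemma eloE k p : 0 < k -> k * elo_lip p < 1 ->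
  elo k p = k *: elo_cl 1 (elo k p) p.
Proof.
move=> k0 kM; rewrite -elo_cl_scale.
(* Banach's theorem is applied on the whole row space; the fixed point is a rating because every
   value of [elo_cl] is one. *)
suff [x xE] : exists x, x = elo_cl k x p.
  have /(xgetPex 0)[] // : exists x, rating x /\ x = elo_cl k x p.
  by exists x; split=> //; rewrite xE; exact: elo_cl_rating.
have f_homo : {homo (fun x => elo_cl k x p) : x / setT x >-> setT x} by [].
have kM0 : 0 <= k * elo_lip p by rewrite mulr_ge0 ?elo_lip_ge0// ltW.
have [|||x _ xE] := @banach_fixed_point _ _ _ (mkfun_fun f_homo).
- exists (NngNum kM0); split=> //= -[x y] _ /=.
  rewrite ![mkfun _ _]elo_cl_scale -scalerBr normrZ gtr0_norm// -mulrA.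
  by rewrite ler_pM2l// elo_cl_lipschitz.
- exact: closedT.
- by exists 0.
- by exists x; exact: xE.
Qed.

(** With x = [elo k p], G(x) = [elo_cl 1 x p] and M = [elo_lip p], the fixed-point equation gives
    |x| <= k (|G(0)| + M |x|); since k M <= 1/2, the last term is absorbed into half of |x|. *)
Lemma elo_norm_le k p : 0 < k -> 2 * k * elo_lip p <= 1 ->
  `|elo k p| <= 2 * k * `|elo_cl 1 0 p|.
Proof.
move=> k0 kM; set x := elo k p.
have M0 := elo_lip_ge0 p.
have xE : x = k *: elo_cl 1 x p by apply: eloE => //; lra.
have Gx : `|elo_cl 1 x p| <= `|elo_cl 1 0 p| + elo_lip p * `|x|.
  have := elo_cl_lipschitz p x 0; rewrite subr0 -lerBlDl.
  by apply: le_trans; exact: lerB_dist.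
have : `|x| <= k * (`|elo_cl 1 0 p| + elo_lip p * `|x|).
  by rewrite {1}xE normrZ gtr0_norm// ler_pM2l.
have : 2 * k * elo_lip p * `|x| <= 1 * `|x| by rewrite ler_wpM2r.
lra.
Qed.

(** The [+ 1] keeps the threshold positive even when [elo_lip p] is zero. *)
Lemma elo_small_step k p : k <= (2 * (elo_lip p + 1))^-1 ->
  0 < k -> 2 * k * elo_lip p <= 1.
Proof.
have M0 := elo_lip_ge0 p => + k0.
by rewrite -[_^-1]mul1r ler_pdivlMr; lra.
Qed.

Lemma elo_step_gt0 p : 0 < (2 * (elo_lip p + 1))^-1.
Proof. by rewrite invr_gt0 mulr_gt0// ltr_wpDl// elo_lip_ge0. Qed.

Lemma elo_cvg0 p : elo k p @[k --> 0^'+] --> (0 : 'rV[R]_n).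
Proof.
apply: (@cvg_at_right0_linear _ _ _ _ (2 * `|elo_cl 1 0 p|)).
  exact: elo_step_gt0 p.
move=> k k0 /elo_small_step/(_ k0) kM.
by rewrite subr0 mulrAC elo_norm_le.
Qed.

Lemma elo_div_cvg p : k^-1 *: elo k p @[k --> 0^'+] --> elo_cl 1 0 p.
Proof.
apply: (@cvg_at_right0_linear _ _ _ _ (elo_lip p * (2 * `|elo_cl 1 0 p|))).
  exact: elo_step_gt0 p.
move=> k k0 /elo_small_step/(_ k0) kM.
have k1 : k * elo_lip p < 1 by lra.
(* Only the outer [elo k p] is unfolded, so [k^-1] cancels and a difference of two values of
   [elo_cl 1] remains. *)
rewrite {1}(eloE k0 k1) scalerA mulVf ?gt_eqF// scale1r.
rewrite (le_trans (elo_cl_lipschitz _ _ _))// subr0 -mulrA.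
by rewrite ler_wpM2l ?elo_lip_ge0// mulrAC elo_norm_le.
Qed.

End elo.

Theorem proposition4p5 (R : realType) (n : nat) (hn : (2 <= n)%N)
    (p : 'M[R]_n) (hp : competition p) (l : R) (hl : 0 < l) :
  [/\ elo k p @[k --> 0^'+] --> (0 : 'rV[R]_n),
      elo l (k *: p) @[k --> 0^'+] --> (0 : 'rV[R]_n),
      k^-1 *: elo k p @[k --> 0^'+] -->
        (\row_i \sum_j (p i j - p j i) / 2 : 'rV[R]_n) &
      (k * l)^-1 *: elo l (k *: p) @[k --> 0^'+] -->
        (\row_i \sum_j (p i j - p j i) / 2 : 'rV[R]_n)].
Proof.
split.
- exact: elo_cvg0.
- under eq_fun do rewrite elo_scaler.
  exact: cvg_at_right0_scale hl (@elo_cvg0 R n p).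
- rewrite -elo_cl0; exact: elo_div_cvg.
- under eq_fun do rewrite elo_scaler.
  (* Naming [f] exhibits the goal as a limit of [f (k * l)]. *)
  rewrite -elo_cl0; pose f k : 'rV[R]_n := k^-1 *: elo k p.
  exact: (cvg_at_right0_scale (f := f) hl (@elo_div_cvg R n p)).
Qed.
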